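(* For each $i\in\omega$ let $\lambda_i\geqslant 1$ be a cardinal, let $S_i$ be a totally countably compact Hausdorff semitopological monoid with zero, and let $B^0_{\lambda_i}(S_i)$ be a Hausdorff countably compact topological Brandt $\lambda_i^0$-extension of $S_i$. Then the direct product $\prod\{B^0_{\lambda_i}(S_i)\colon i\in\omega\}$ with the Tychonoff topology is a Hausdorff totally countably compact semitopological semigroup.
   Context: All topological spaces are Hausdorff. A semitopological semigroup is a Hausdorff topological space with a separately continuous associative operation; a semitopological monoid is a semitopological semigroup with identity. Direct products of semigroups carry the coordinatewise operation. Brandt $\lambda^0$-extension: for a monoid $S$ with zero $0_S$ and a cardinal $\lambda\geqslant 1$, $B^0_\lambda(S)$ is the set $\{(\alpha,s,\beta)\colon \alpha,\beta\in\lambda,\ s\in S\setminus\{0_S\}\}\sqcup\{0\}$ with the operation in which $0$ is the zero and $(\alpha,a,\beta)\cdot(\gamma,b,\delta)$ equals $(\alpha,ab,\delta)$ if $\beta=\gamma$ and $ab\neq 0_S$, and equals $0$ otherwise. For $\alpha,\beta\in\lambda$ put $S_{\alpha,\beta}=\{(\alpha,s,\beta)\colon s\in S\setminus\{0_S\}\}\cup\{0\}$. Topological Brandt $\lambda^0$-extension: for a semitopological monoid $(S,\tau)$ with zero, it is $B^0_\lambda(S)$ with a Hausdorff topology $\tau_B$ such that $(B^0_\lambda(S),\tau_B)$ is a semitopological semigroup and, for some $\alpha\in\lambda$, the map $0_S\mapsto 0$, $s\mapsto(\alpha,s,\alpha)$ ($s\neq 0_S$) is a homeomorphism of $(S,\tau)$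 onto the subspace $S_{\alpha,\alpha}$. A space is countably compact if each countable open cover has a finite subcover, and totally countably compact if every countably infinite subset contains an infinite subset with compact closure. *)

(* Defs.v *)
From HB Require Import structures.
From mathcomp Require Import all_boot.
From mathcomp Require Import all_classical topology.

Set Implicit Arguments.
Unset Strict Implicit.
Unset Printing Implicit Defensive.

Local Open Scope classical_set_scope.
Local Open Scope card_scope.
Local Open Scope group_scope.

HB.mixin Record Monoid_hasZero S of monoid.Monoid S := {
  zerog : S;
  mul0g : left_zero zerog (@monoid.mul S);
  mulg0 : right_zero zerog (@monoid.mul S)
}.

#[short(type="monoid0Type")]
HB.structure Definition Monoid0 := {S of monoid.Monoid S & Monoid_hasZero S}.

(* No compatibility between the operation and the topology is built into these
   two structures; see [semitopological_semigroup]. *)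
#[short(type="preTopSemigroupType")]
HB.structure Definition PreTopSemigroup :=
  {S of monoid.Semigroup S & Topological S}.

#[short(type="preTopMonoid0Type")]
HB.structure Definition PreTopMonoid0 := {S of Monoid0 S & Topological S}.

Definition semitopological_semigroup (S : preTopSemigroupType) : Prop :=
  hausdorff_space S /\
  forall a : S, continuous (fun x : S => a * x) /\
                continuous (fun x : S => x * a).

Definition countably_compact (T : topologicalType) : Prop :=
  forall F : set (set T),
    countable F -> F `<=` open -> \bigcup_(U in F) U = [set: T] ->
    exists G : set (set T),
      [/\ finite_set G, G `<=` F & \bigcup_(U in G) U = [set: T]].

Definition totally_countably_compact (T : topologicalType) : Prop :=
  forall A : set T, A #= [set: nat] ->
    exists B : set T, [/\ B `<=` A, infinite_set B & compact (closure B)].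

Section ProductSemigroup.
Variables (I : Type) (S : I -> preTopSemigroupType).

Definition prod_mul (f g : prod_topology S) : prod_topology S :=
  fun i => f i * g i.

Lemma prod_mulA : associative prod_mul.
Proof. by move=> f g h; apply: functional_extensionality_dep => i; exact: mulgA. Qed.

HB.instance Definition _ := monoid.isSemigroup.Build (prod_topology S) prod_mulA.

End ProductSemigroup.

(* A topology as data, so that one can quantify over the topologies of a fixed
   set; [topologize t] is the carrier of [t] with [t] as canonical topology. *)
Record topology_on (T : Type) := TopologyOn {
  topo_open : set (set T);
  topo_openT : topo_open [set: T];
  topo_openI : forall A B, topo_open A -> topo_open B -> topo_open (A `&` B);
  topo_open_bigcup : forall F : set (set T),
    F `<=` topo_open -> topo_open (\bigcup_(U in F) U)
}.

Definition topologize (T : Type) (t : topology_on T) : Type := T.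

Section Topologize.
Variables (T : choiceType) (t : topology_on T).

HB.instance Definition _ := Choice.copy (topologize t) T.

Lemma topologize_openI :
  setI_closed (topo_open t : set_system (topologize t)).
Proof. by move=> A B; exact: topo_openI. Qed.

Lemma topologize_open_bigcup (I : Type) (f : I -> set (topologize t)) :
  (forall i, topo_open t (f i)) -> topo_open t (\bigcup_i f i).
Proof.
move=> fo; rewrite -(bigcup_image setT f id).
by apply: topo_open_bigcup => _ [i _ <-]; exact: fo.
Qed.

HB.instance Definition _ := isOpenTopological.Build (topologize t)
  (topo_openT t) topologize_openI topologize_open_bigcup.

End Topologize.

HB.instance Definition _ (T : semigroupType) (t : topology_on T) :=
  monoid.Semigroup.copy (topologize t) T.

(* [None] is the zero of the Brandt extension. *)
Definition brandt (L : choiceType) (S : monoid0Type) : Type :=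
  option (L * {s : S | s != zerog} * L).

Section Brandt.
Variables (L : choiceType) (S : monoid0Type).
Local Notation B := (brandt L S).

HB.instance Definition _ := Choice.on B.

(* [0] if [s] is the zero of [S], and the triple [(a, s, b)] otherwise. *)
Definition brandt_elt (a : L) (s : S) (b : L) : B :=
  omap (fun s' => (a, s', b)) (insub s).

Definition brandt_mul (x y : B) : B :=
  match x, y with
  | Some (a, s, b), Some (c, t, d) =>
      if b == c then brandt_elt a (val s * val t) d else None
  | _, _ => None
  end.

Lemma brandt_mulA : associative brandt_mul.
Proof.
have elt0 a b : brandt_elt a zerog b = None.
  by rewrite /brandt_elt insubF ?eqxx.
have mul_eltl a s b c (t : {s : S | s != zerog}) d :
    brandt_mul (brandt_elt a s b) (Some (c, t, d)) =
    if b == c then brandt_elt a (s * val t) d else None.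
  rewrite {1}/brandt_elt; case: insubP => [s' _ <- //|] /=.
  by rewrite negbK => /eqP ->; rewrite mul0g elt0 if_same.
have mul_eltr a s b c (t : {s : S | s != zerog}) d :
    brandt_mul (Some (c, t, d)) (brandt_elt a s b) =
    if d == a then brandt_elt c (val t * s) b else None.
  rewrite {1}/brandt_elt; case: insubP => [s' _ <- //|] /=.
  by rewrite negbK => /eqP ->; rewrite mulg0 elt0 if_same.
have mul0r x : brandt_mul x None = None by case: x => [[[]]|].
move=> [[[a s] b]|] [[[c t] d]|] [[[e u] f]|]; rewrite ?mul0r //.
rewrite [brandt_mul (Some (c, t, d)) _]/=.
rewrite [brandt_mul (Some (a, s, b)) (Some (c, t, d))]/=.
case: (eqVneq d e) => de; case: (eqVneq b c) => bc.
- by rewrite mul_eltl mul_eltr bc de !eqxx mulgA.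
- by rewrite mul_eltr (negPf bc).
- by rewrite mul_eltl (negPf de).
- by [].
Qed.

HB.instance Definition _ := monoid.isSemigroup.Build B brandt_mulA.

(* The set [S_{a,b}]. *)
Definition brandt_block (a b : L) : set B :=
  [set x | x = None \/ exists s, x = Some (a, s, b)].

End Brandt.

Definition homeomorphism_onto (X Y : topologicalType) (f : X -> Y) (A : set Y)
    : Prop :=
  [/\ set_bij [set: X] A f, continuous f &
      exists2 g : Y -> X, cancel f g & {within A, continuous g}].

Definition topological_brandt_extension (L : choiceType)
    (S : preTopMonoid0Type) (t : topology_on (brandt L S)) : Prop :=
  semitopological_semigroup (topologize t) /\
  exists a : L, homeomorphism_onto
    (fun s : S => brandt_elt a s a : topologize t)
    (brandt_block a a : set (topologize t)).

(* Main.v *)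
Require Import Defs.
From mathcomp Require Import all_boot.
From mathcomp Require Import all_classical topology.

(** The coordinatewise operation on a product of semitopological semigroups is
separately continuous, and products of Hausdorff spaces are Hausdorff, so the
content is total countable compactness. For Hausdorff spaces it is equivalent
to a property of sequences, [compact_subsequences]: every sequence has a
subsequence lying in a compact set. In that form it passes to countable
products ([compact_subsequences_prod]): refine the subsequence for one
coordinate after another, diagonalize, and enclose the diagonal subsequence in
a product of compact sets, which is compact by Tychonoff's theorem.

It remains to see that a countably compact Brandt extension [B] of a totally
countably compact monoid [S] has this property
([compact_subsequences_brandt]). Only separate continuity is needed, applied
to maps [x |-> u * x * v]:
- each [S_{b,c}] is a continuous image of [S], because [S_{a,a}] is one for
  some [a] and [(b,1,a) * S_{a,a} * (a,1,c) = S_{b,c}];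
- each [S_{b,c}] without zero is open, being the set of those [x] for which
  [(b,1,b) * x * (c,1,c)] is nonzero.
A sequence that visits one block infinitely often is handled by the property
of [S]. A sequence that visits each block only finitely often converges to
zero: were it to stay infinitely often outside a neighbourhood of zero, the
corresponding subsequence would have a cluster point by countable compactness;
this cluster point is not zero, and it is not in a nonzero block either,
because that block is open and is visited only finitely often. A convergent
sequence together with its limit is compact. *)

Set Implicit Arguments.
Unset Strict Implicit.
Unset Printing Implicit Defensive.

Local Open Scope classical_set_scope.

(** * Sequences and subsequences *)

Lemma infinite_natP (M : set nat) :
  infinite_set M <-> forall k, exists2 n, M n & (k <= n)%N.
Proof.
split=> [Minf k|Munb].
  have /infinite_setN0 [n [Mn /negP nk]] := infinite_setD Minf (finite_II k).
  by exists n => //; rewrite leqNgt.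
case/finite_seqP => s Ms; have [n] := Munb (\max_(i <- s) i).+1.
by rewrite Ms /= => sn; rewrite ltnNge (@leq_bigmax_seq _ _ xpredT id).
Qed.

(** The diagonal of a chain of successive refinements lies in each member of the
chain up to finitely many terms. Refining so as to obtain [P 0], [P 1], ... in
turn therefore serves all the [P i] at once, at that price. *)
Lemma diagonal_infinite_set (P : nat -> set nat -> Prop) (N : set nat) :
  infinite_set N ->
  (forall i N, infinite_set N ->
    exists M, [/\ M `<=` N, infinite_set M & P i M]) ->
  exists D, [/\ D `<=` N, infinite_set D &
    forall i, exists2 M, P i M & finite_set (D `\` M)].
Proof.
move=> Ninf refine.
have /choice [h hP] : forall iN : nat * set nat, exists M,
    infinite_set iN.2 -> [/\ M `<=` iN.2, infinite_set M & P iN.1 M].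
  case=> i A; have [Afin|Ainf] := pselect (finite_set A).
    by exists A => /(_ Afin).
  by have [M HM] := refine i A Ainf; exists M.
pose C := fix C k := if k is k'.+1 then h (k', C k') else N.
have Cinf k : infinite_set (C k).
  by elim: k => [|k IHk]; [exact: Ninf|case: (hP (k, C k) IHk)].
have CS k : C k.+1 `<=` C k by case: (hP (k, C k) (Cinf k)).
have CP k : P k (C k.+1) by case: (hP (k, C k) (Cinf k)).
have Cle i k : (i <= k)%N -> C k `<=` C i.
  move=> /subnK <-; elim: (k - i)%N => [|j IHj] //.
  by rewrite addSn; apply: subset_trans IHj.
have /choice [f fP] : forall k, exists n, C k.+1 n /\ (k <= n)%N.
  by move=> k; have /infinite_natP/(_ k) [n] := Cinf k.+1; exists n.
exists (range f); split.
- by move=> _ [k _ <-]; apply: (@Cle 0 k.+1) => //; case: (fP k).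
- by apply/infinite_natP => k; exists (f k); [exists k|case: (fP k)].
- move=> i; exists (C i.+1) => //.
  apply: sub_finite_set (finite_image f (finite_II i)) => _ [[k _ <-] nCk].
  exists k => //=; rewrite ltnNge; apply/negP => ik.
  by apply: nCk; apply: (@Cle _ k.+1); [rewrite ltnS|case: (fP k)].
Qed.

(** Sequences replace countably infinite sets here because a coordinate
projection may collapse such a set, whereas a projected sequence is still a
sequence; subsequences are encoded by their infinite sets of indices. *)
Definition compact_subsequences (T : topologicalType) : Prop :=
  forall (x : nat -> T) (N : set nat), infinite_set N ->
    exists M, [/\ M `<=` N, infinite_set M &
      exists2 K, compact K & x @` M `<=` K].

(** A finite range needs no hypothesis on the space; compact sets being closed,
lying in one is the same as having compact closure. *)
Lemma compact_subsequencesP (T : topologicalType) : hausdorff_space T ->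
  totally_countably_compact T <-> compact_subsequences T.
Proof.
move=> hT; split=> [tccT x N Ninf|subT A].
  have [fin|inf] := pselect (finite_set (x @` N)).
    by exists N; split=> //; exists (x @` N) => //; exact: finite_compact.
  have cxN : countable (x @` N).
    exact: card_le_trans (card_image_le _ _) (countableP _).
  have [|B [BA Binf cB]] := tccT (x @` N).
    by rewrite card_eq_le; apply/andP; split=> //; apply/infiniteP.
  exists (N `&` x @^-1` B); split; first by move=> n [].
    move=> /(finite_image x); apply: contra_not Binf; apply: sub_finite_set.
    move=> y By; have [n Nn xny] := BA y By.
    by exists n => //; split=> //=; rewrite xny.
  by exists (closure B) => // _ [n [_ Bxn] <-]; exact: subset_closure.
move=> /card_set_bijP [f [_ finj fsurj]].
have /choice [x xP] : forall n, exists a, A a /\ f a = n.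
  by move=> n; have [a Aa fan] := fsurj n I; exists a.
have [M [_ Minf [K cK xMK]]] := subT x setT infinite_nat.
exists (x @` M); split; first by move=> _ [n _ <-]; case: (xP n).
  move=> /(finite_image f); apply: contra_not Minf; apply: sub_finite_set.
  by move=> n Mn; exists (x n); [exists n|case: (xP n)].
apply: (subclosed_compact _ cK); first exact: closed_closure.
have /closure_id -> := compact_closed hT cK.
exact: closureS.
Qed.

(** Otherwise every point has a neighbourhood missing the tail of the sequence
from some index on. The interiors of the complements of the tails then form an
increasing countable open cover, and a finite subcover would make some tail
empty. *)
Lemma countably_compact_cluster (T : topologicalType) (x : nat -> T)
    (M : set nat) : countably_compact T -> infinite_set M ->
  exists y : T, forall V, nbhs y V -> infinite_set (M `&` x @^-1` V).
Proof.
move=> ccT Minf; apply: contrapT => /forallNP noy.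
pose F k := (~` (x @` (M `&` [set n | (k <= n)%N])))°.
have [|_ [k _ <-]||G [Gfin GF Gcov]] := ccT (range F).
- exact: card_le_trans (card_image_le _ _) (countableP _).
- exact: open_interior.
- rewrite -subTset => y _.
  have /existsNP [V /not_implyP [yV /contrapT fin]] := noy y.
  have [k kP] : exists k, forall n, M n -> V (x n) -> (n < k)%N.
    apply: contrapT => /forallNP unb; apply: (_ : infinite_set _) fin.
    apply/infinite_natP => k.
    have /existsNP [n /not_implyP [Mn /not_implyP [Vn nk]]] := unb k.
    by exists n => //; rewrite leqNgt; apply/negP.
  exists (F k); first by exists k.
  apply: filterS yV => z Vz [n [Mn /= kn] xnz].
  by have := kP n Mn; rewrite xnz ltnNge kn => /(_ Vz).
have [k kP] : exists k, G `<=` [set F i | i in `I_k].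
  have /choice [g gP] : forall U, exists i, G U -> F i = U.
    move=> U; have [GU|nGU] := pselect (G U); last by exists 0%N.
    by have [i _ <-] := GF U GU; exists i.
  have /finite_seqP [s gs] := finite_image g Gfin.
  exists (\max_(i <- s) i).+1 => U GU; exists (g U); last exact: gP.
  rewrite /= ltnS; apply: (@leq_bigmax_seq _ _ xpredT id) => //.
  by have : (g @` G) (g U) by [exists U]; rewrite gs.
have /infinite_natP/(_ k) [n Mn kn] := Minf.
have : [set: T] (x n) by [].
rewrite -Gcov => -[U /kP [i /= ik <-]] /interior_subset; apply.
by exists n => //; split=> //=; apply: leq_trans kn; exact: ltnW.
Qed.

(** A filter that does not cluster at [p] avoids a neighbourhood of [p], so it
lives on the finitely many terms outside this neighbourhood. *)
Lemma compact_cvg_range (T : topologicalType) (x : nat -> T) (M : set nat)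
    (p : T) :
  (forall U, nbhs p U -> finite_set (M `\` x @^-1` U)) ->
  compact (p |` x @` M).
Proof.
move=> xp F PF FK; have [pF|npF] := pselect (cluster F p).
  by exists p; split=> //; left.
have [A [U [FA pU AU]]] : exists A U, [/\ F A, nbhs p U & A `&` U = set0].
  move: npF => /existsNP [A /existsNP [U]].
  move=> /not_implyP [FA /not_implyP [pU /nonemptyPn AU]].
  by exists A, U.
have cK := finite_compact (finite_image x (xp U pU)).
have [|y [[n [Mn _] <-] Fy]] := cK F PF; last first.
  by exists (x n); split=> //; right; exists n.
have disj z : A z -> U z -> False.
  by move=> Az Uz; rewrite -[False]/(set0 z) -AU.
apply: filterS (filterI FK FA) => z [[->|[n Mn <-]] Az].
  by case: (disj p Az); exact: nbhs_singleton.
by exists n => //; split=> //; exact: disj.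
Qed.

(** * Countable products *)

Lemma compact_subsequences_prod (T : nat -> topologicalType) :
  (forall i, compact_subsequences (T i)) ->
  compact_subsequences (prod_topology T).
Proof.
move=> subT x N Ninf.
pose P i (M : set nat) := exists2 K, compact K & (fun n => x n i) @` M `<=` K.
have [i M Minf|D [DN Dinf DP]] := @diagonal_infinite_set P N Ninf.
  exact: (subT i (fun n => x n i) M Minf).
have exK : forall i, exists K : set (T i),
    compact K /\ forall n, D n -> K (x n i).
  move=> i; have [M [K cK xMK] DMfin] := DP i.
  exists (K `|` (fun n => x n i) @` (D `\` M)); split.
    by apply: compactU => //; apply: finite_compact; apply: finite_image.
  move=> n Dn; have [Mn|nMn] := pselect (M n).
    by left; apply: xMK; exists n.
  by right; exists n.
pose K i := projT1 (cid (exK i)).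
have KP i : compact (K i) /\ forall n, D n -> K i (x n i) := projT2 (cid (exK i)).
exists D; split=> //; exists [set f | forall i, K i (f i)].
  by apply: tychonoff => i; case: (KP i).
by move=> _ [n Dn <-] i; case: (KP i) => _; apply.
Qed.

Lemma continuous_into_prod (X : topologicalType) (I : Type)
    (T : I -> topologicalType) (f : X -> prod_topology T) :
  (forall i, continuous (fun x => f x i)) -> continuous f.
Proof.
move=> fc x; apply/cvg_sup => i A /= [_ [[B Bop <-] Bfx BA]].
by apply: filterS BA _; apply: fc; exact: open_nbhs_nbhs.
Qed.

Lemma semitopological_semigroup_prod (I : eqType) (S : I -> preTopSemigroupType) :
  (forall i, semitopological_semigroup (S i)) ->
  semitopological_semigroup (prod_topology S).
Proof.
move=> stS; split; first by apply: hausdorff_product => i; case: (stS i).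
move=> a; split; apply: continuous_into_prod => i f.
  apply: (@cvg_comp _ _ _ (@proj _ S i) (fun y => (a i * y)%g) _ (nbhs (f i))).
    exact: (@proj_continuous I (fun j => S j) i f).
  by case: (stS i) => _ /(_ (a i)) [+ _]; apply.
apply: (@cvg_comp _ _ _ (@proj _ S i) (fun y => (y * a i)%g) _ (nbhs (f i))).
  exact: (@proj_continuous I (fun j => S j) i f).
by case: (stS i) => _ /(_ (a i)) [_]; apply.
Qed.

(** * Brandt extensions *)

Section BrandtAlgebra.
Variables (L : choiceType) (S : monoid0Type).
Implicit Types (a b c d : L) (s t : S) (x : brandt L S).
Local Open Scope group_scope.

Lemma brandt_elt0 a b : brandt_elt a (zerog : S) b = None.
Proof. by rewrite /brandt_elt insubF ?eqxx. Qed.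

Lemma brandt_eltM a b d s t :
  brandt_elt a s b * brandt_elt b t d = brandt_elt a (s * t) d.
Proof.
have [->|s0] := eqVneq s zerog; first by rewrite mul0g !brandt_elt0.
have [->|t0] := eqVneq t zerog.
  by rewrite mulg0 !brandt_elt0; case: (brandt_elt a s b) => [[[]]|].
by rewrite {1 2}/brandt_elt !insubT {1}/mul /= eqxx.
Qed.

(** The nonzero elements of [S_{a,b}] are those of index [Some (a, b)]; the zero,
common to all blocks, gets an index of its own, so that the blocks become
disjoint. *)
Definition brandt_index x : option (L * L) :=
  omap (fun u => (u.1.1, u.2)) x.

Lemma brandt_index_elt x a b :
  brandt_index x = Some (a, b) -> exists s, x = brandt_elt a s b.
Proof.
case: x => [[[c s] d]|] //= [-> ->]; exists (val s).
by rewrite /brandt_elt valK.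
Qed.

(** Multiplication by diagonal idempotents on both sides isolates one block;
this is how an algebraic fact makes the blocks open. *)
Lemma brandt_cornerP x a b :
  brandt_elt a 1 a * x * brandt_elt b 1 b <> None <->
  brandt_index x = Some (a, b).
Proof.
case: x => [[[c s] d]|] /=; last first.
  by rewrite /brandt_elt; case: insubP => [u _ _|_]; split.
(* A nonzero element forces [1] to differ from the zero of [S], so that the
   idempotents [(a, 1, a)] and [(b, 1, b)] are nonzero. *)
have S10 : (1 : S) != zerog.
  by apply: contraTneq (valP s) => S10; rewrite -[val s]mul1g S10 mul0g eqxx.
rewrite /brandt_elt insubT /= {1}/mul {1}/mul /=.
case: eqVneq => [->|ac]; last by split=> // -[] ca _; rewrite ca eqxx in ac.
rewrite /= mul1g /brandt_elt valK /=.
case: eqVneq => [->|db]; last by split=> // -[] bd; rewrite bd eqxx in db.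
by rewrite mulg1 /brandt_elt valK; split.
Qed.

End BrandtAlgebra.

Section TopologicalBrandt.
Variables (L : choiceType) (S : preTopMonoid0Type) (t : topology_on (brandt L S)).
Local Notation B := (topologize t).
Hypothesis extB : topological_brandt_extension t.
Local Open Scope group_scope.

Lemma continuous_mul_lr (u v : B) : continuous (fun x : B => u * x * v).
Proof.
case: extB => -[_ mulc] _ x; have [uc _] := mulc u; have [_ vc] := mulc v.
exact: (@cvg_comp _ _ _ (fun y : B => u * y) (fun y : B => y * v)
  _ _ _ (uc x) (vc _)).
Qed.

(** The definition gives this on one diagonal block only; translations carry it
to all the others. *)
Lemma continuous_brandt_elt b c : continuous (fun s : S => brandt_elt b s c : B).
Proof.
have [_ [a [_ ac _]]] := extB.
pose f (x : B) : B := (brandt_elt b 1 a : B) * x * brandt_elt a 1 c.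
pose g (s : S) : B := brandt_elt a s a.
have -> : (fun s : S => brandt_elt b s c : B) = f \o g.
  have fgE (s : S) :
      brandt_elt b 1 a * brandt_elt a s a * brandt_elt a 1 c = brandt_elt b s c.
    by rewrite !brandt_eltM mul1g mulg1.
  by apply/funext => s; exact: esym (fgE s).
move=> s; apply: continuous_comp; first exact: ac.
exact: continuous_mul_lr.
Qed.

Lemma open_brandt_index b c :
  open [set x : B | brandt_index x = Some (b, c)].
Proof.
pose f (x : B) : B := (brandt_elt b 1 b : B) * x * brandt_elt c 1 c.
have -> : [set x : B | brandt_index x = Some (b, c)] = f @^-1` ~` [set None : B].
  by apply/seteqP; split=> x /brandt_cornerP.
apply: open_comp => [x _|]; first exact: continuous_mul_lr.
rewrite openC; apply: accessible_closed_set1; apply: hausdorff_accessible.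
by case: extB => -[].
Qed.

Lemma compact_subsequences_brandt :
  compact_subsequences S -> countably_compact B -> compact_subsequences B.
Proof.
move=> subS ccB x N Ninf.
have [[o oinf]|nofiber] := pselect (exists o,
    infinite_set (N `&` [set n | brandt_index (x n) = o])).
  case: o oinf => [[b c]|] oinf.
    have /choice [s xs] : forall n, exists s, brandt_index (x n) = Some (b, c) ->
        x n = brandt_elt b s c.
      move=> n; have [/brandt_index_elt [s xs]|nx] :=
        pselect (brandt_index (x n) = Some (b, c)); first by exists s.
      by exists 1 => /nx.
    have [M [MN Minf [K cK sMK]]] := subS s _ oinf.
    exists M; split=> //; first by move=> n /MN [].
    exists ((fun s : S => brandt_elt b s c : B) @` K).
      apply: continuous_compact cK; apply: continuous_subspaceT.
      exact: continuous_brandt_elt.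
    move=> _ [n Mn <-]; have [_ /= xn] := MN n Mn.
    by exists (s n); [apply: sMK; exists n|rewrite xs].
  exists (N `&` [set n | brandt_index (x n) = None]); split=> //.
  exists [set None : B]; first exact: compact_set1.
  by move=> _ [n [_ /=] + <-]; case: (x n).
(* Each block is visited finitely often, so the sequence converges to zero. *)
exists N; split=> //; exists ((None : B) |` x @` N); last by move=> y; right.
apply: compact_cvg_range => U U0; apply: contrapT => Minf.
have [y yP] := countably_compact_cluster x ccB Minf.
case Dy: (brandt_index y) => [[b c]|]; last first.
  have y0 : y = None by case: y Dy {yP}.
  rewrite y0 in yP; have := yP U U0; apply; apply: sub_finite_set (finite_set0 _).
  by move=> n [[_]].
have Vy : nbhs y [set z : B | brandt_index z = Some (b, c)].
  by apply: open_nbhs_nbhs; split=> //; exact: open_brandt_index.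
apply: nofiber; exists (Some (b, c)); apply: sub_infinite_set (yP _ Vy).
by move=> n [[Nn _]].
Qed.

End TopologicalBrandt.

Theorem theorem2p6 (L : nat -> choiceType) (S : nat -> preTopMonoid0Type)
    (tau : forall i : nat, topology_on (brandt (L i) (S i))) :
  (forall i, inhabited (L i)) ->
  (forall i, semitopological_semigroup (S i)) ->
  (forall i, totally_countably_compact (S i)) ->
  (forall i, topological_brandt_extension (tau i)) ->
  (forall i, countably_compact (topologize (tau i))) ->
  let P := prod_topology (fun i : nat => topologize (tau i)) in
  [/\ hausdorff_space P,
      totally_countably_compact P &
      semitopological_semigroup P].
Proof.
move=> _ stS tccS extB ccB P.
have stP : semitopological_semigroup P.
  by apply: semitopological_semigroup_prod => i; case: (extB i).
have hP : hausdorff_space P by case: stP.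
split=> //; apply/compact_subsequencesP => //.
apply: compact_subsequences_prod => i.
apply: compact_subsequences_brandt => //.
by apply/compact_subsequencesP => //; case: (stS i).
Qed.
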